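(* Let $k$ be an algebraically closed field and let $Q$ be a star shaped quiver. For any two exceptional representations $\rho,\rho'\in\mathrm{Rep}_k(Q)$ whose dimension vectors are each hill or thin and are not both hill, the linear map $F_{\rho,\rho'}$ has maximal rank. In particular, for any two such $\rho,\rho'$ we have $\hom(\rho,\rho')=0$ or $\hom^1(\rho,\rho')=0$.
   Context: A star shaped quiver is a quiver, with any orientation of the arrows, whose underlying graph consists of a central vertex $s$ with $r\geq 3$ arms (rays) attached: each arm is a path $u_1 - u_2 - \cdots - u_{m-1} - s$ with $m\geq 2$ ($m$ may depend on the arm), the arms being disjoint apart from $s$. A vector $\alpha\in\mathbb N^{V(Q)}$ (with $0\in\mathbb N$) is hill if along each arm $\alpha(u_1)\leq\alpha(u_2)\leq\dots\leq\alpha(u_{m-1})\leq\alpha(s)$ and $\alpha(u_{m-1})>0$. It is thin if $\alpha_i=1$ for every $i$ with $\alpha_i\neq 0$. $V(Q)$, $Arr(Q)$ are the vertices and arrows of $Q$; $s(a),t(a)$ are the origin and end of an arrow $a$. $\mathrm{Rep}_k(Q)$ is the category of finite-dimensional $k$-representations; $\hom=\dim_k\mathrm{Hom}$, $\hom^1=\dim_k\mathrm{Ext}^1$. A representation $\rho$ is exceptional if $\mathrm{Hom}(\rho,\rho)=k$ and $\mathrm{Ext}^1(\rho,\rho)=0$. For representations $\rho,\rho'$ with dimension vectors $\alpha,\alpha'$, given by linear maps $\rho_a:k^{\alpha_{s(a)}}\to k^{\alpha_{t(a)}}$, $\rho'_a:k^{\alpha'_{s(a)}}\to k^{\alpha'_{t(a)}}$,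 the map $F_{\rho,\rho'}$ is $$F_{\rho,\rho'}:\prod_{i\in V(Q)}\mathrm{Hom}(k^{\alpha_i},k^{\alpha'_i})\to\prod_{a\in Arr(Q)}\mathrm{Hom}(k^{\alpha_{s(a)}},k^{\alpha'_{t(a)}}),\qquad \{f_i\}_{i}\mapsto\{f_{t(a)}\circ\rho_a-\rho'_a\circ f_{s(a)}\}_{a}.$$ A linear map has maximal rank if it is injective or surjective. *)

(* Defs.v *)
From HB Require Import structures.
From mathcomp Require Import all_boot all_order all_algebra.

Set Implicit Arguments.
Unset Strict Implicit.
Unset Printing Implicit Defensive.

Import GRing.Theory.
Local Open Scope ring_scope.

(* The k-vector space prod_(i : I) Hom(k^(n i), k^(m i)). A linear map        *)
(* k^q -> k^p is a matrix in 'M_(p, q) acting on column vectors, so that      *)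
(* g \o f is g *m f.                                                          *)
Section MxFam.
Variables (k : fieldType) (I : finType) (m n : I -> nat).

Record mxfam := MxFam { mxfam_val : {dffun forall i : I, 'M[k]_(m i, n i)} }.

HB.instance Definition _ := [isNew for mxfam_val].
HB.instance Definition _ := [Choice of mxfam by <:].

Definition mxfam_fun (f : mxfam) : forall i, 'M[k]_(m i, n i) := mxfam_val f.
Coercion mxfam_fun : mxfam >-> Funclass.

Definition mxfam_of (g : forall i, 'M[k]_(m i, n i)) : mxfam :=
  MxFam (finfun g).

Lemma mxfam_ofE g i : mxfam_of g i = g i.
Proof. by rewrite /mxfam_fun ffunE. Qed.

Lemma mxfamP (f g : mxfam) : (forall i, f i = g i) <-> f = g.
Proof. by split=> [fg | -> //]; apply/val_inj/ffunP. Qed.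

Definition mxfam0 := mxfam_of (fun=> 0).
Definition mxfam_opp (f : mxfam) := mxfam_of (fun i => - f i).
Definition mxfam_add (f g : mxfam) := mxfam_of (fun i => f i + g i).
Definition mxfam_scale (c : k) (f : mxfam) :=
  mxfam_of (fun i => c *: f i).

Lemma mxfam_addA : associative mxfam_add.
Proof. by move=> f g h; apply/mxfamP => i; rewrite !mxfam_ofE addrA. Qed.
Lemma mxfam_addC : commutative mxfam_add.
Proof. by move=> f g; apply/mxfamP => i; rewrite !mxfam_ofE addrC. Qed.
Lemma mxfam_add0 : left_id mxfam0 mxfam_add.
Proof. by move=> f; apply/mxfamP => i; rewrite !mxfam_ofE add0r. Qed.
Lemma mxfam_addN : left_inverse mxfam0 mxfam_opp mxfam_add.
Proof. by move=> f; apply/mxfamP => i; rewrite !mxfam_ofE addNr. Qed.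

HB.instance Definition _ := GRing.isZmodule.Build mxfam
  mxfam_addA mxfam_addC mxfam_add0 mxfam_addN.

Lemma mxfam_addE (f g : mxfam) i : (f + g) i = f i + g i.
Proof. exact: mxfam_ofE. Qed.
Lemma mxfam_oppE (f : mxfam) i : (- f) i = - f i.
Proof. exact: mxfam_ofE. Qed.
Lemma mxfam_0E i : (0 : mxfam) i = 0.
Proof. exact: mxfam_ofE. Qed.

Lemma mxfam_scaleA a b (f : mxfam) :
  mxfam_scale a (mxfam_scale b f) = mxfam_scale (a * b) f.
Proof. by apply/mxfamP => i; rewrite !mxfam_ofE scalerA. Qed.
Lemma mxfam_scale1 : left_id 1 mxfam_scale.
Proof. by move=> f; apply/mxfamP => i; rewrite !mxfam_ofE scale1r. Qed.
Lemma mxfam_scaleDr : right_distributive mxfam_scale +%R.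
Proof.
by move=> a f g; apply/mxfamP => i; rewrite !(mxfam_ofE, mxfam_addE) scalerDr.
Qed.
Lemma mxfam_scaleDl (f : mxfam) :
  {morph mxfam_scale^~ f : a b / a + b}.
Proof.
by move=> a b; apply/mxfamP => i; rewrite !(mxfam_ofE, mxfam_addE) scalerDl.
Qed.

HB.instance Definition _ := GRing.Zmodule_isLmodule.Build k mxfam
  mxfam_scaleA mxfam_scale1 mxfam_scaleDr mxfam_scaleDl.

Lemma mxfam_scaleE c (f : mxfam) i : (c *: f) i = c *: f i.
Proof. exact: mxfam_ofE. Qed.

Fact mxfam_vect_iso :
  Vector.axiom #|{: {i : I & ('I_(m i) * 'I_(n i))%type}}| mxfam.
Proof.
pose T := {i : I & ('I_(m i) * 'I_(n i))%type}.
pose cf (f : mxfam) (t : T) := f (tag t) (tagged t).1 (tagged t).2.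
exists (fun f => \row_t cf f (enum_val t)).
  move=> a f g; apply/rowP => t.
  have cfD u : cf (a *: f + g) u = a * cf f u + cf g u.
    by rewrite /cf mxfam_addE mxfam_scaleE !mxE.
  by rewrite mxE cfD !mxE.
pose mk (r : 'rV[k]_#|{: T}|) : mxfam := mxfam_of (fun i =>
  \matrix_(x, y) r 0 (enum_rank (Tagged
    (fun i => ('I_(m i) * 'I_(n i))%type) (x, y)))).
exists mk => [f | r].
  by apply/mxfamP => i; apply/matrixP => x y; rewrite mxfam_ofE !mxE enum_rankK.
apply/rowP => t; rewrite mxE /cf mxfam_ofE mxE.
by congr (r _ _); rewrite -[RHS]enum_valK; case: (enum_val t) => i [x y].
Qed.

HB.instance Definition _ :=
  Lmodule_hasFinDim.Build k mxfam mxfam_vect_iso.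

End MxFam.

Arguments mxfam k [I] m n.

Record quiver := Quiver {
  vertex :> finType;
  arrow : finType;
  src : arrow -> vertex;
  tgt : arrow -> vertex }.

(* Every finite-dimensional representation is isomorphic to one whose spaces  *)
(* are the coordinate spaces k^(alpha i).                                     *)
Record rep (k : fieldType) (Q : quiver) := Rep {
  dimvec : Q -> nat;
  rep_map : forall a : arrow Q, 'M[k]_(dimvec (tgt a), dimvec (src a)) }.

Section Representations.
Variables (k : fieldType) (Q : quiver).
Implicit Types rho : rep k Q.

Notation vertex_homs rho rho' := (mxfam k (dimvec rho') (dimvec rho)).

Notation arrow_homs rho rho' :=
  (mxfam k (fun a : arrow Q => dimvec rho' (tgt a))
          (fun a : arrow Q => dimvec rho (src a))).

Definition Fmap rho rho' (f : vertex_homs rho rho') : arrow_homs rho rho' :=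
  mxfam_of (fun a : arrow Q =>
    f (tgt a) *m rep_map rho a - rep_map rho' a *m f (src a)).

Lemma FmapE rho rho' (f : vertex_homs rho rho') (a : arrow Q) :
  Fmap f a = f (tgt a) *m rep_map rho a - rep_map rho' a *m f (src a).
Proof. exact: mxfam_ofE. Qed.

Fact Fmap_is_linear rho rho' : linear (@Fmap rho rho').
Proof.
move=> c f g; apply/mxfamP => a.
rewrite [RHS]mxfam_addE mxfam_scaleE !FmapE !mxfam_addE !mxfam_scaleE.
rewrite mulmxDl mulmxDr -scalemxAl -scalemxAr scalerBr opprD.
by rewrite addrACA.
Qed.

HB.instance Definition _ rho rho' :=
  GRing.isLinear.Build k (vertex_homs rho rho') (arrow_homs rho rho') *:%R
    (@Fmap rho rho') (@Fmap_is_linear rho rho').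

Definition F rho rho' : 'Hom(vertex_homs rho rho', arrow_homs rho rho') :=
  linfun (@Fmap rho rho').

Definition is_morphism rho rho' (f : vertex_homs rho rho') : Prop :=
  forall a : arrow Q,
    f (tgt a) *m rep_map rho a = rep_map rho' a *m f (src a).

Definition HomRep rho rho' : {vspace vertex_homs rho rho'} := lker (F rho rho').

Lemma mem_HomRep rho rho' (f : vertex_homs rho rho') :
  f \in HomRep rho rho' <-> is_morphism f.
Proof.
rewrite memv_ker lfunE /=; split=> [/eqP f0 a | fM].
  move/mxfamP/(_ a): f0; rewrite [RHS]mxfam_0E FmapE => /eqP.
  by rewrite subr_eq0 => /eqP.
by apply/eqP/mxfamP => a; rewrite [RHS]mxfam_0E FmapE fM subrr.
Qed.

Definition dim_hom rho rho' : nat := \dim (HomRep rho rho').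

Definition id_rep rho : vertex_homs rho rho := mxfam_of (fun=> 1%:M).

(* Short exact sequences 0 -> rho' -> E -> rho -> 0, the elements of the      *)
(* Yoneda Ext^1(rho, rho') up to ext_equiv below. Exactness is vertexwise.    *)
Record extension rho rho' := Extension {
  ext_mid : rep k Q;
  ext_inc : vertex_homs rho' ext_mid;
  ext_proj : vertex_homs ext_mid rho;
  ext_inc_morphism : is_morphism ext_inc;
  ext_proj_morphism : is_morphism ext_proj;
  ext_inc_inj : forall (i : Q) (u : 'cV[k]_(dimvec rho' i)),
    ext_inc i *m u = 0 -> u = 0;
  ext_proj_surj : forall (i : Q) (w : 'cV[k]_(dimvec rho i)),
    exists v, ext_proj i *m v = w;
  ext_exact : forall (i : Q) (v : 'cV[k]_(dimvec ext_mid i)),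
    ext_proj i *m v = 0 <-> exists u, ext_inc i *m u = v }.

(* By the five lemma such an f is automatically an isomorphism.               *)
Definition ext_equiv rho rho' (E E' : extension rho rho') : Prop :=
  exists f : vertex_homs (ext_mid E) (ext_mid E'),
    [/\ is_morphism f,
        forall i : Q, f i *m ext_inc E i = ext_inc E' i
      & forall i : Q, ext_proj E' i *m f i = ext_proj E i].

Definition dsum_rep rho rho' : rep k Q :=
  @Rep k Q (fun i => dimvec rho i + dimvec rho' i)%N
    (fun a => block_mx (rep_map rho a) 0 0 (rep_map rho' a)).

Definition dsum_inl rho rho' : vertex_homs rho (dsum_rep rho rho') :=
  mxfam_of (fun i => col_mx 1%:M 0).

Definition dsum_pr2 rho rho' : vertex_homs (dsum_rep rho rho') rho' :=
  mxfam_of (fun i => row_mx 0 1%:M).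

Fact dsum_inl_morphism rho rho' : is_morphism (dsum_inl rho rho').
Proof.
move=> a; rewrite !mxfam_ofE /= mul_col_mx mul_block_col.
by rewrite mul1mx !mulmx1 !mul0mx !mulmx0 !addr0.
Qed.

Fact dsum_pr2_morphism rho rho' : is_morphism (dsum_pr2 rho rho').
Proof.
move=> a; rewrite !mxfam_ofE /= mul_mx_row mul_row_block.
by rewrite !mul1mx mulmx1 !mul0mx !mulmx0 !add0r.
Qed.

Fact dsum_inl_inj rho rho' (i : Q) (u : 'cV[k]_(dimvec rho i)) :
  dsum_inl rho rho' i *m u = 0 -> u = 0.
Proof.
rewrite mxfam_ofE mul_col_mx mul1mx mul0mx => h.
by rewrite -(col_mxKu u 0 : usubmx (col_mx u (0 : 'cV_(dimvec rho' i))) = u)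
           h linear0.
Qed.

Fact dsum_pr2_surj rho rho' (i : Q) (w : 'cV[k]_(dimvec rho' i)) :
  exists v, dsum_pr2 rho rho' i *m v = w.
Proof.
by exists (col_mx 0 w); rewrite mxfam_ofE mul_row_col mulmx0 mul1mx add0r.
Qed.

Fact dsum_exact rho rho' (i : Q) (v : 'cV[k]_(dimvec (dsum_rep rho rho') i)) :
  dsum_pr2 rho rho' i *m v = 0 <-> exists u, dsum_inl rho rho' i *m u = v.
Proof.
rewrite !mxfam_ofE; split=> [|[u <-]]; last first.
  by rewrite mulmxA mul_row_col mul0mx mulmx0 addr0 mul0mx.
move: v => /= v; rewrite -{1}(vsubmxK v) mul_row_col mul0mx mul1mx add0r => v0.
exists (usubmx v); rewrite mul_col_mx mul1mx mul0mx.
by rewrite -[RHS]vsubmxK v0.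
Qed.

Definition trivial_ext rho rho' : extension rho rho' :=
  Extension (@dsum_inl_morphism rho' rho) (@dsum_pr2_morphism rho' rho)
    (@dsum_inl_inj rho' rho) (@dsum_pr2_surj rho' rho) (@dsum_exact rho' rho).

(* Ext^1(rho, rho') = 0, equivalently hom^1(rho, rho') = 0: every class of    *)
(* extensions is the zero class, that of the trivial extension.               *)
Definition Ext1_eq0 rho rho' : Prop :=
  forall E : extension rho rho', ext_equiv E (trivial_ext rho rho').

(* Hom(rho, rho) = k: the map c |-> c * id from k to Hom(rho, rho) is         *)
(* bijective; its injectivity (uniqueness of c) rules out rho = 0.            *)
Definition exceptional rho : Prop :=
  (forall f, f \in HomRep rho rho -> exists! c : k, f = c *: id_rep rho)
  /\ Ext1_eq0 rho rho.

End Representations.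

Definition maximal_rank (k : fieldType) (U V : vectType k) (g : 'Hom(U, V)) :=
  injective g \/ (forall v : V, exists u : U, g u = v).

Local Open Scope nat_scope.

Definition joins (Q : quiver) (a : arrow Q) (x y : Q) : Prop :=
  (src a = x /\ tgt a = y) \/ (src a = y /\ tgt a = x).

(* The arm u_1 - u_2 - ... - u_(m-1) - s numbered j is given by               *)
(* u_(i+1) = star_arm j i for i < m - 1 and s = star_arm j (m - 1), where     *)
(* m = star_m j; the values star_arm j i with m <= i are irrelevant.          *)
Record star_shape (Q : quiver) := StarShape {
  star_r : nat;
  star_m : 'I_star_r -> nat;
  star_center : Q;
  star_arm : 'I_star_r -> nat -> Q;
  star_r_ge3 : 3 <= star_r;
  star_m_ge2 : forall j, 2 <= star_m j;
  star_arm_end : forall j, star_arm j (star_m j).-1 = star_center;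
  star_arm_neq_center : forall j i,
    i < (star_m j).-1 -> star_arm j i <> star_center;
  star_arm_inj : forall j i j' i',
    i < (star_m j).-1 -> i' < (star_m j').-1 ->
    star_arm j i = star_arm j' i' -> j = j' /\ i = i';
  star_cover : forall v : Q, exists j i, i < star_m j /\ star_arm j i = v;
  star_edge : forall j i, i.+1 < star_m j ->
    exists! a : arrow Q, joins a (star_arm j i) (star_arm j i.+1);
  star_arrow : forall a : arrow Q, exists j i,
    i.+1 < star_m j /\ joins a (star_arm j i) (star_arm j i.+1) }.

Definition hill (Q : quiver) (S : star_shape Q) (alpha : Q -> nat) : Prop :=
  forall j : 'I_(star_r S),
    (forall i : nat, i.+1 < star_m j ->
       alpha (star_arm j i) <= alpha (star_arm j i.+1))
    /\ (0 < alpha (star_arm j (star_m j).-2)).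

Definition thin (Q : quiver) (alpha : Q -> nat) : Prop :=
  forall i : Q, alpha i <> 0 -> alpha i = 1.

(* Main.v *)
Require Import Defs.
From mathcomp Require Import all_boot all_order all_algebra.

Set Implicit Arguments.
Unset Strict Implicit.
Unset Printing Implicit Defensive.

Import GRing.Theory.
Local Open Scope ring_scope.

Local Notation vertex_homs k rho rho' := (mxfam k (dimvec rho') (dimvec rho)).
Local Notation arrow_homs k rho rho' :=
  (mxfam k (fun a => dimvec rho' (tgt a)) (fun a => dimvec rho (src a))).

(** The kernel of F is Hom and its cokernel is Ext1, so everything amounts to
    the claim that a nonzero morphism [f : rho -> rho'] forces F to be onto. Two
    consequences of the rigidity [Ext1 rho rho = 0] of an exceptional
    representation carry the proof.

    First, every structure map of a rigid representation has maximal rank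
    ([rigid_maximal_rank]). So on a hill dimension vector the maps are injective
    towards the center and surjective away from it, and on a thin one they are
    nonzero wherever both ends carry a line. Second, [f] induces a map from
    [Ext1 rho' rho'], which is zero, to [Ext1 rho rho'], so every cocycle that
    factors through [f] at the sources of arrows is in the image of F
    ([rigid_pullback]). When [rho] is thin this covers the components at all
    arrows whose source is a vertex where [f] does not vanish. Had [f] been
    injective there would be nothing else to do; the remaining arrows are
    handled with the shape of the supports.

    The endomorphisms of a thin exceptional [rho] being scalars, its support is
    connected, hence convex in the tree ([brick_supp_convex]). If both
    representations are thin, their common support is convex and [f] vanishes
    nowhere on it, and each arrow at which cocycles can be nonzero has its
    source there ([thin_thin_src]). If [rho] is thin and [rho'] is hill, the
    nonvanishing of [f] propagates towards the center inside the support of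
    [rho] ([msupp_up_closed]); the other vertices of the support form outer stretches
    of the arms, along which a cocycle is pushed towards the center by
    coboundaries until [rigid_pullback] applies ([thin_hill_edge_onto_step]).
    If [rho] is hill and [rho'] is thin, transposition reduces to the opposite
    quiver ([Fonto_dual]). *)

(** * Matrices *)

Section Matrices.
Variable k : fieldType.

Lemma mulmx_lift_cols m n p (A : 'M[k]_(m, n)) (B : 'M_(m, p)) :
  (forall j, exists v : 'cV_n, A *m v = col j B) -> exists C, A *m C = B.
Proof.
move=> /fin_all_exists [v vP]; exists (\matrix_(i, j) v j i 0).
apply/matrixP => i j; have /colP/(_ i) := vP j; rewrite !mxE => <-.
by apply: eq_bigr => l _; rewrite mxE.
Qed.

Lemma mulmx_ker0_inj m n p (A : 'M[k]_(m, n)) (B C : 'M_(n, p)) :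
  (forall u : 'cV_n, A *m u = 0 -> u = 0) -> A *m B = A *m C -> B = C.
Proof.
move=> A0 eqAB; apply/eqP; rewrite -subr_eq0; apply/eqP.
apply/matrixP => i j.
have /colP/(_ i) : col j (B - C) = 0.
  by apply: A0; rewrite colE mulmxA mulmxBr eqAB subrr mul0mx.
by rewrite !mxE.
Qed.

Lemma mx0_rows m n (A : 'M[k]_(m, n)) : m = 0%N -> A = 0.
Proof. by move=> m0; move: A; rewrite m0 => A; apply: flatmx0. Qed.

Lemma mx0_cols m n (A : 'M[k]_(m, n)) : n = 0%N -> A = 0.
Proof. by move=> n0; move: A; rewrite n0 => A; apply: thinmx0. Qed.

Lemma row_full_mulmx0 m n p (A : 'M[k]_(m, n)) (B : 'M_(n, p)) :
  row_full A -> A *m B = 0 -> B = 0.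
Proof.
by case/row_fullP=> A' A'A AB0; rewrite -[B]mul1mx -A'A -mulmxA AB0 mulmx0.
Qed.

Lemma row_free_mulmx0 m n p (A : 'M[k]_(m, n)) (B : 'M_(p, m)) :
  row_free A -> B *m A = 0 -> B = 0.
Proof.
by case/row_freeP=> A' AA' BA0; rewrite -[B]mulmx1 -AA' mulmxA BA0 mul0mx.
Qed.

Lemma row_full_col m n (A : 'M[k]_(m, n)) :
  (n <= 1)%N -> A != 0 -> row_full A.
Proof.
move=> n1 A0; rewrite /row_full eqn_leq rank_leq_col (leq_trans n1) //.
by rewrite lt0n mxrank_eq0.
Qed.

End Matrices.

(** * The group Ext1 as the cokernel of F *)

Section Extensions.
Variables (k : fieldType) (Q : quiver).
Implicit Types rho : rep k Q.

Definition Fonto rho rho' := forall y, exists f, @Fmap k Q rho rho' f = y.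

(** The middle term of the extension with cocycle [y]; the direct sum is the
    case [y = 0], and its inclusion and projection serve for every [y]. *)
Definition glue_rep rho rho' (y : arrow_homs k rho rho') : rep k Q :=
  @Rep k Q (fun i => dimvec rho' i + dimvec rho i)%N
    (fun a => block_mx (rep_map rho' a) (y a) 0 (rep_map rho a)).

Lemma glue_inl_morphism rho rho' (y : arrow_homs k rho rho') :
  @is_morphism k Q rho' (glue_rep y) (dsum_inl rho' rho).
Proof.
move=> a; rewrite /dsum_inl !mxfam_ofE /= mul_col_mx mul_block_col.
by rewrite mul1mx !mulmx1 !mul0mx !mulmx0 !addr0.
Qed.

Lemma glue_pr2_morphism rho rho' (y : arrow_homs k rho rho') :
  @is_morphism k Q (glue_rep y) rho (dsum_pr2 rho' rho).
Proof.
move=> a; rewrite /dsum_pr2 !mxfam_ofE /= mul_mx_row mul_row_block.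
by rewrite !mul1mx mulmx1 !mul0mx !mulmx0 !add0r.
Qed.

Definition glue_ext rho rho' (y : arrow_homs k rho rho') : extension rho rho' :=
  @Extension k Q rho rho' (glue_rep y) (dsum_inl rho' rho) (dsum_pr2 rho' rho)
    (glue_inl_morphism y) (glue_pr2_morphism y)
    (@dsum_inl_inj k Q rho' rho) (@dsum_pr2_surj k Q rho' rho)
    (@dsum_exact k Q rho' rho).

(** A splitting of the extension with cocycle [y] is unipotent and upper
    triangular, and its upper right block is, up to sign, a preimage of [y]. *)
Lemma Ext1_eq0_onto rho rho' : Ext1_eq0 rho rho' -> Fonto rho rho'.
Proof.
move=> ext0 y; have [f [fM fi fp]] := ext0 (glue_ext y).
have {}fi i : (f i : 'M_(dimvec rho' i + dimvec rho i)) *m col_mx 1%:M 0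
              = col_mx 1%:M 0.
  by have := fi i; rewrite /= /dsum_inl mxfam_ofE.
have {}fp i : row_mx 0 1%:M *m (f i : 'M_(dimvec rho' i + dimvec rho i))
              = row_mx 0 1%:M.
  by have := fp i; rewrite /= /dsum_pr2 mxfam_ofE.
pose h i := ursubmx (f i : 'M_(dimvec rho' i + dimvec rho i)).
have fE i : f i = block_mx 1%:M (h i) 0 1%:M.
  have := fi i; have := fp i; rewrite /h -[f i]submxK block_mxKur.
  rewrite mul_row_block mul_block_col !mul0mx !mul1mx !add0r !mulmx0 !addr0.
  rewrite !mulmx1 => /eq_row_mx[-> ->] /eq_col_mx[-> _] //.
exists (- mxfam_of h); apply/mxfamP => a.
rewrite FmapE !mxfam_oppE !mxfam_ofE mulNmx mulmxN opprK.
have := fM a; rewrite !fE /= !mulmx_block.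
rewrite !mul1mx !mul0mx !mulmx0 !mulmx1 !addr0 !add0r.
by case/eq_block_mx => _ <- _ _; rewrite addrC addrK.
Qed.

(** A vertexwise section of the projection fails to be a morphism by a cocycle
    [y]; writing [y] as a value of F corrects the section to a morphism, which
    splits the extension. *)
Lemma onto_Ext1_eq0 rho rho' : Fonto rho rho' -> Ext1_eq0 rho rho'.
Proof.
move=> onto [E inc proj incM projM inc_inj proj_surj exE].
have lift i p (Y : 'M_(dimvec E i, p)) :
    proj i *m Y = 0 -> exists U, inc i *m U = Y.
  move=> pY0; apply: mulmx_lift_cols => j; apply/exE.
  by rewrite colE mulmxA pY0 mul0mx.
have pi0 i : proj i *m inc i = 0.
  apply/matrixP => x j.
  have /exE/colP/(_ x) : exists u, inc i *m u = col j (inc i).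
    by exists (delta_mx j 0); rewrite colE.
  by rewrite colE mulmxA -colE !mxE.
have /fin_all_exists[s sP] i : exists s, proj i *m s = 1%:M.
  by apply: mulmx_lift_cols => j; apply: proj_surj.
have /fin_all_exists[y yP] (a : arrow Q) : exists U, inc (tgt a) *m U
    = rep_map E a *m s (src a) - s (tgt a) *m rep_map rho a.
  apply: lift; rewrite mulmxBr !mulmxA sP mul1mx projM.
  by rewrite -mulmxA sP mulmx1 subrr.
have [h /mxfamP hP] := onto (mxfam_of y).
pose s' i := s i + inc i *m h i.
have s'P i : proj i *m s' i = 1%:M.
  by rewrite mulmxDr sP mulmxA pi0 mul0mx addr0.
have s'M a : rep_map E a *m s' (src a) = s' (tgt a) *m rep_map rho a.
  apply/eqP; rewrite -subr_eq0 /s' mulmxDr mulmxDl opprD addrACA -yP.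
  rewrite mulmxA -incM -!mulmxA -mulmxBr -mulmxDr.
  have := hP a; rewrite FmapE mxfam_ofE => <-.
  by rewrite addrC addrA subrK subrr mulmx0.
have /fin_all_exists[r rP] i : exists U, inc i *m U = 1%:M - s' i *m proj i.
  by apply: lift; rewrite mulmxBr mulmxA s'P mul1mx mulmx1 subrr.
exists (mxfam_of (fun i => col_mx (r i) (proj i))); split.
- move=> a; rewrite !mxfam_ofE /= mul_col_mx mul_block_col !mul0mx addr0 add0r.
  congr col_mx; last exact: projM.
  apply: (mulmx_ker0_inj (inc_inj _)).
  rewrite mulmxA rP mulmxA incM -mulmxA rP mulmxBl mulmxBr mul1mx mulmx1.
  by rewrite -mulmxA projM !mulmxA s'M.
- move=> i; rewrite /= /dsum_inl !mxfam_ofE mul_col_mx pi0; congr col_mx.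
  apply: (mulmx_ker0_inj (inc_inj _)).
  by rewrite mulmxA rP mulmxBl mul1mx -mulmxA pi0 mulmx0 subr0 mulmx1.
- by move=> i; rewrite /= /dsum_pr2 !mxfam_ofE mul_row_col mul0mx mul1mx add0r.
Qed.

End Extensions.

(** * Rigid representations *)

Section Rigid.
Variables (k : fieldType) (Q : quiver).
Implicit Types rho : rep k Q.

(** A matrix that is neither injective nor surjective has a nonzero covector
    and a nonzero vector annihilated on either side; the pairing of both with
    [g *m A - A *m h] vanishes, although it is nonzero for a suitable matrix
    unit. *)
Lemma rigid_maximal_rank rho a : Fonto rho rho ->
  row_full (rep_map rho a) || row_free (rep_map rho a).
Proof.
move=> onto; set A := rep_map rho a.
rewrite -kermx_eq0 -cokermx_eq0.
apply: contraT; rewrite negb_or => /andP[].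
move=> /matrix0Pn[q [j Cqj]] /matrix0Pn[i [p Kip]].
pose X := delta_mx p q : 'M[k]_(dimvec rho (tgt a), dimvec rho (src a)).
have [g /mxfamP/(_ a)] := onto (mxfam_of (fun b => conform_mx 0 X)).
rewrite FmapE mxfam_ofE conform_mx_id -/A => gX.
have /matrixP/(_ i j) : kermx A *m X *m cokermx A = 0.
  rewrite -gX mulmxBr (mulmxA _ A) mulmx_ker mul0mx subr0.
  by rewrite -!mulmxA mulmx_coker !mulmx0.
rewrite /X -(mul_delta_mx (0 : 'I_1)) mulmxA -colE -mulmxA -rowE.
rewrite [LHS]mxE [RHS]mxE big_ord1.
rewrite [X in X * _]mxE [X in _ * X]mxE => /eqP.
by rewrite mulf_eq0 (negPf Kip) (negPf Cqj).
Qed.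

Lemma rigid_row_full rho a : Fonto rho rho ->
  (dimvec rho (src a) <= dimvec rho (tgt a))%N -> row_full (rep_map rho a).
Proof.
move=> onto le_st; case/orP: (rigid_maximal_rank a onto) => // /eqP rk.
by rewrite /row_full eqn_leq rank_leq_col rk.
Qed.

Lemma rigid_row_free rho a : Fonto rho rho ->
  (dimvec rho (tgt a) <= dimvec rho (src a))%N -> row_free (rep_map rho a).
Proof.
move=> onto le_ts; case/orP: (rigid_maximal_rank a onto) => // /eqP rk.
by rewrite /row_free eqn_leq rank_leq_row rk.
Qed.

(** A morphism [f : rho -> rho'] induces a map from [Ext1 rho' rho'], which is
    zero, to [Ext1 rho rho']; on cocycles it sends [X] to [X a *m f (src a)].
    A component of [y] factors in this way wherever [f (src a)] is injective. *)
Lemma rigid_pullback rho rho' (f : vertex_homs k rho rho')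
    (y : arrow_homs k rho rho') :
  Fonto rho' rho' -> is_morphism f ->
  (forall a, row_full (f (src a)) || (y a == 0)) -> exists g, Fmap g = y.
Proof.
move=> onto fM yP.
have [g gE] := onto (mxfam_of (fun a => y a *m pinvmx (f (src a)))).
exists (mxfam_of (fun i => g i *m f i)); apply/mxfamP => a.
rewrite FmapE !mxfam_ofE -mulmxA fM !mulmxA -mulmxBl.
have /mxfamP/(_ a) := gE; rewrite FmapE mxfam_ofE => ->.
case/orP: (yP a) => [ffull | /eqP->]; last by rewrite !mul0mx.
by rewrite -mulmxA mulVpmx ?mulmx1.
Qed.

End Rigid.

(** * Cuts and convex vertex sets in a star *)

Section Star.
Variables (Q : quiver) (S : star_shape Q).
Local Notation arm := (star_arm (s := S)).
Local Notation len j := (star_m (s := S) j).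
Local Open Scope nat_scope.
Implicit Types (A B C : pred Q) (x y v : Q).

Lemma len_gt0 j : 0 < len j.
Proof. exact: leq_trans (star_m_ge2 j). Qed.

Lemma len_predK j : (len j).-1.+1 = len j.
Proof. exact: prednK (len_gt0 j). Qed.

Lemma arm_inj j i j' i' : i < (len j).-1 -> i' < len j' ->
  arm j i = arm j' i' -> j = j' /\ i = i'.
Proof.
move=> lti; rewrite -(len_predK j') ltnS leq_eqVlt => /orP[/eqP-> | lti' E].
  by rewrite star_arm_end => /(star_arm_neq_center lti).
exact: star_arm_inj E.
Qed.

(** One of the two components left by removing the edge between [arm j i] and
    [arm j i.+1]. *)
Definition below j i : pred Q := fun v => [exists l : 'I_i.+1, v == arm j l].

Lemma below_arm j i j' i' : i < (len j).-1 -> i' < len j' ->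
  below j i (arm j' i') = (j' == j) && (i' <= i).
Proof.
move=> lti lti'; apply/existsP/andP => [[l /eqP E] | [/eqP-> lei]].
  have ltl : l < (len j).-1 by rewrite (leq_ltn_trans _ lti) // -ltnS.
  have [<- <-] := arm_inj ltl lti' (esym E).
  by rewrite eqxx -ltnS.
by exists (Ordinal (lei : i' < i.+1)).
Qed.

Lemma below_edge j i a : i < (len j).-1 ->
  below j i (src a) != below j i (tgt a) -> joins a (arm j i) (arm j i.+1).
Proof.
move=> lti; have [j' [i' [lti' ja]]] := star_arrow S a.
suff: below j i (arm j' i') != below j i (arm j' i'.+1) ->
      joins a (arm j i) (arm j i.+1).
  by case: (ja) => -[-> ->] //; rewrite eq_sym.
rewrite !below_arm ?(ltnW lti') //.
case: (j' =P j) => [jE | _] //=; rewrite -jE.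
by case: (ltngtP i' i) => // <- _; apply: ja.
Qed.

(** A form of connectedness suited to a tree: a set meeting both sides of a cut
    contains the edge that was cut. Unlike connectedness, it is visibly stable
    under intersection. *)
Definition convex A := forall j i x y, i < (len j).-1 ->
  A x -> below j i x -> A y -> ~~ below j i y -> A (arm j i) && A (arm j i.+1).

Lemma convexI A A' : convex A -> convex A' -> convex (predI A A').
Proof.
move=> cA cA' j i x y lti /= /andP[Ax A'x] bx /andP[Ay A'y] by_.
have /andP[-> ->] := cA j i x y lti Ax bx Ay by_.
by have /andP[-> ->] := cA' j i x y lti A'x bx A'y by_.
Qed.

Lemma convex_below A j i x y : convex A -> i < (len j).-1 ->
  ~~ (A (arm j i) && A (arm j i.+1)) -> A x -> A y ->
  below j i x = below j i y.
Proof.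
move=> cA lti nA Ax Ay; case bx: (below j i x); case by_: (below j i y) => //.
  by case/negP: nA; apply: (cA _ _ x y); rewrite ?by_.
by case/negP: nA; apply: (cA _ _ y x); rewrite ?bx.
Qed.

Definition up_closed A B := forall j i, i < (len j).-1 ->
  B (arm j i) -> A (arm j i.+1) -> B (arm j i.+1).

(** Climbing the arm from a point of [B] towards a point [y] of [A], convexity
    keeps the path inside [A]. *)
Lemma up_closed_climb A B j l n y : convex A -> subpred B A -> up_closed A B ->
  B (arm j l) -> A y -> l <= n < len j ->
  (forall i, l <= i < n -> ~~ below j i y) -> B (arm j n).
Proof.
move=> cA sBA uB Bl Ay; elim: n => [|n IH] /andP[ln ltn] ny.
  by move: ln Bl; rewrite leqn0 => /eqP->.
move: ln; rewrite leq_eqVlt => /orP[/eqP<- // | ln].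
have lt' : n < (len j).-1 by rewrite ltn_predRL.
have Bn : B (arm j n).
  apply: IH => [|i /andP[li ni]]; first by rewrite -ltnS ln ltnW.
  by apply: ny; rewrite li ltnW.
have nb : ~~ below j n y by apply: ny; rewrite -ltnS ln leqnn.
apply: uB => //.
have bn : below j n (arm j n) by rewrite below_arm ?eqxx ?leqnn // ltnW.
by have /andP[] := cA j n (arm j n) y lt' (sBA _ Bn) bn Ay nb.
Qed.

Lemma up_closed_center A B x : convex A -> subpred B A -> up_closed A B ->
  B x -> A (star_center S) -> B (star_center S).
Proof.
move=> cA sBA uB Bx Ac; have [j [l [ltl xE]]] := star_cover S x.
rewrite -(star_arm_end j).
apply: (up_closed_climb (A := A) (l := l) (y := star_center S)) => //.
- by rewrite xE.
- by rewrite -ltnS len_predK ltl leqnn.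
move=> i /andP[_ lti]; rewrite -(star_arm_end j) below_arm //.
  by rewrite eqxx -ltnNge.
by rewrite -{2}(len_predK j).
Qed.

(** Otherwise the set [A], which is cut after [arm j i], would lie entirely on
    the outer side, and climbing from [x] would reach [arm j i] inside [B]. *)
Lemma up_closed_exit A B j i x : convex A -> subpred B A -> up_closed A B ->
  B x -> i < (len j).-1 -> A (arm j i) -> ~~ B (arm j i) -> A (arm j i.+1).
Proof.
move=> cA sBA uB Bx lti Ai nBi; apply: contraR nBi => nA.
have lti1 : i < len j by rewrite (leq_trans lti) // leq_pred.
have : below j i x.
  rewrite (convex_below (y := arm j i) cA lti _ (sBA _ Bx) Ai).
    by rewrite below_arm ?eqxx ?leqnn.
  by rewrite (negPf nA) andbF.
case/existsP => l /eqP xE.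
apply: (up_closed_climb (A := A) (l := l) (y := arm j i)) => //.
- by rewrite -xE.
- by rewrite -ltnS ltn_ord.
move=> n /andP[_ ltn]; rewrite below_arm ?eqxx -?ltnNge //.
exact: ltn_trans ltn lti.
Qed.

(** Both [B] and its complement are closed under moving towards the center
    inside [C]. Two points that [B] separates would thus be compared either at
    the center or, when [C] misses the center, on a common arm. *)
Lemma convex_connected C B x y : convex C ->
  (forall a, C (src a) -> C (tgt a) -> B (src a) = B (tgt a)) ->
  C x -> C y -> B x -> B y.
Proof.
move=> cC iB Cx Cy Bx; apply: contraTT isT => nBy.
have iBarm j i : i < (len j).-1 -> C (arm j i) -> C (arm j i.+1) ->
    B (arm j i) = B (arm j i.+1).
  rewrite ltn_predRL => lti Ci Ci1; have [a [ja _]] := star_edge lti.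
  by case: ja Ci Ci1 => -[<- <-] Ci Ci1; rewrite iB.
pose B1 := predI C B; pose B2 := predD C B.
have u1 : up_closed C B1.
  by move=> j i lti /andP[Ci Bi] /= Ci1; rewrite Ci1 -iBarm.
have u2 : up_closed C B2.
  by move=> j i lti /= /andP[Bi Ci] /= Ci1; rewrite Ci1 -iBarm // Bi.
have s1 : subpred B1 C by move=> v /andP[].
have s2 : subpred B2 C by move=> v /andP[].
have B1x : B1 x by rewrite /= Cx.
have B2y : B2 y by rewrite /= nBy.
have [/= Cc | nCc] := boolP (C (star_center S)).
  have /= /andP[_] := up_closed_center cC s1 u1 B1x Cc.
  by have /= /andP[/negPf->] := up_closed_center cC s2 u2 B2y Cc.
have [j [l [ltl xE]]] := star_cover S x.
(* As [C] misses the center, it lies on one side of the last cut of the arm. *)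
pose i := (len j).-2.
have i1E : i.+1 = (len j).-1 by rewrite prednK // -ltnS len_predK star_m_ge2.
have lti : i < (len j).-1 by rewrite -i1E.
have : below j i y.
  rewrite -(convex_below (x := x) cC lti) //; last first.
    by rewrite i1E star_arm_end (negPf nCc) andbF.
  rewrite -xE below_arm // eqxx -ltnS i1E ltn_neqAle -ltnS len_predK ltl andbT.
  by apply: contra nCc => /eqP lE; rewrite -(star_arm_end j) -lE xE.
case/existsP => l' /eqP yE.
have ltl' : l' < len j by rewrite (leq_trans (ltn_ord l')) // i1E leq_pred.
have climb D l1 l2 : subpred D C -> up_closed C D -> D (arm j l1) ->
    C (arm j l2) -> l1 <= l2 < len j -> D (arm j l2).
  move=> sD uD D1 C2 /andP[l12 lt2].
  apply: (up_closed_climb cC sD uD D1 C2); first by rewrite l12.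
  move=> n /andP[_ ltn]; rewrite below_arm ?eqxx -?ltnNge //.
  by rewrite ltn_predRL (leq_ltn_trans ltn).
case: (leqP l l') => [ll' | /ltnW l'l].
  have := climb B1 l l' s1 u1; rewrite xE -yE ll' ltl' => /(_ B1x Cy isT).
  by rewrite /= (negPf nBy) andbF.
have := climb B2 l' l s2 u2; rewrite xE -yE l'l ltl => /(_ B2y Cx isT).
by rewrite /= Bx.
Qed.

End Star.

(** * Supports of thin bricks *)

Section Support.
Variables (k : fieldType) (Q : quiver).
Implicit Types rho : rep k Q.

Definition brick rho := forall f : vertex_homs k rho rho,
  is_morphism f -> exists c : k, f = c *: id_rep rho.

Definition supp rho : pred Q := fun v => (0 < dimvec rho v)%N.
Definition msupp rho rho' (f : vertex_homs k rho rho') : pred Q :=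
  fun v => f v != 0.

Lemma dim0_suppN rho v : ~~ supp rho v -> dimvec rho v = 0%N.
Proof. by rewrite -eqn0Ngt => /eqP. Qed.

Lemma msupp_supp rho rho' (f : vertex_homs k rho rho') v :
  msupp f v -> supp rho v && supp rho' v.
Proof.
apply: contraTT; rewrite negb_and negbK => /orP[] /dim0_suppN d0; apply/eqP.
  exact: mx0_cols.
exact: mx0_rows.
Qed.

Lemma msupp_neq0 rho rho' (f : vertex_homs k rho rho') :
  f <> 0 -> exists v, msupp f v.
Proof.
move=> f0; apply/existsP; apply: contra_notT f0 => /existsPn f0.
by apply/mxfamP => v; rewrite mxfam_0E; apply/eqP/negPn/f0.
Qed.

(** A function that is constant along the arrows inside the support acts on
    [rho] by scalars, vertex by vertex; this endomorphism of a brick is a global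
    scalar. *)
Lemma brick_supp_connected rho (P : pred Q) x y : brick rho ->
  (forall a, supp rho (src a) -> supp rho (tgt a) -> P (src a) = P (tgt a)) ->
  supp rho x -> supp rho y -> P x = P y.
Proof.
move=> br cP xA yA.
pose f : vertex_homs k rho rho := mxfam_of (fun v => (P v)%:R%:M).
have [|c fE] := br f.
  move=> a; rewrite !mxfam_ofE mul_scalar_mx mul_mx_scalar.
  case: (posnP (dimvec rho (src a))) => [s0 | spos].
    by rewrite (mx0_cols (rep_map rho a) s0) !scaler0.
  case: (posnP (dimvec rho (tgt a))) => [t0 | tpos].
    by rewrite (mx0_rows (rep_map rho a) t0) !scaler0.
  by rewrite cP.
have Pc v : supp rho v -> (P v)%:R = c.
  move=> vA; have /mxfamP/(_ v)/matrixP := fE.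
  move=> /(_ (Ordinal vA) (Ordinal vA)).
  by rewrite mxfam_scaleE !mxfam_ofE !mxE eqxx mulr1.
have := etrans (Pc x xA) (esym (Pc y yA)).
by case: (P x); case: (P y) => // /eqP; rewrite ?(eq_sym 0) oner_eq0.
Qed.

Lemma brick_supp_convex (S : star_shape Q) rho :
  brick rho -> convex S (supp rho).
Proof.
move=> br j i x y lti Ax bx Ay; apply: contraNT => nA.
rewrite -(brick_supp_connected (P := below j i) br _ Ax Ay) // => a As At.
apply: contraNeq nA => /(below_edge lti).
by case=> -[<- <-]; rewrite As At.
Qed.

Lemma thin_le1 (alpha : Q -> nat) v : thin alpha -> (alpha v <= 1)%N.
Proof. by case E: (alpha v) => [|n] // th; rewrite -E th // E. Qed.

Lemma thin_row_full rho a : thin (dimvec rho) -> Fonto rho rho ->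
  supp rho (tgt a) -> row_full (rep_map rho a).
Proof.
move=> th onto At; apply: rigid_row_full => //.
by apply: leq_trans At; apply: thin_le1.
Qed.

Lemma thin_row_free rho a : thin (dimvec rho) -> Fonto rho rho ->
  supp rho (src a) -> row_free (rep_map rho a).
Proof.
move=> th onto As; apply: rigid_row_free => //.
by apply: leq_trans As; apply: thin_le1.
Qed.

Lemma thin_msupp_row_full rho rho' (f : vertex_homs k rho rho') v :
  thin (dimvec rho) -> msupp f v -> row_full (f v).
Proof. by move=> th; apply: row_full_col; apply: thin_le1. Qed.

End Support.

(** * Two thin representations *)

Section ThinThin.
Variables (k : fieldType) (Q : quiver) (S : star_shape Q).
Variables (rho rho' : rep k Q) (f : vertex_homs k rho rho').
Hypotheses (th : thin (dimvec rho)) (th' : thin (dimvec rho')).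
Hypotheses (br : brick rho) (br' : brick rho').
Hypotheses (onto : Fonto rho rho) (onto' : Fonto rho' rho').
Hypotheses (fM : is_morphism f) (f0 : f <> 0).

Local Notation A := (supp rho).
Local Notation A' := (supp rho').

(** Inside the common support both representations act by invertible scalars, so
    the vanishing of [f] does not change along an arrow. *)
Lemma thin_thin_msupp v : A v -> A' v -> msupp f v.
Proof.
have [w fw] := msupp_neq0 f0; have /andP[Aw A'w] := msupp_supp fw.
move=> Av A'v.
have cC := convexI (@brick_supp_convex _ _ S _ br)
                   (@brick_supp_convex _ _ S _ br').
apply: (convex_connected cC _ _ _ fw); rewrite /= ?Aw ?Av //.
move=> a /andP[As A's] /andP[At A't]; apply/idP/idP; apply: contraNN.
  move=> /eqP ft; apply/eqP/(row_full_mulmx0 (thin_row_full th' onto' A't)).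
  by rewrite -fM ft mul0mx.
move=> /eqP fs; apply/eqP/(row_free_mulmx0 (thin_row_free th onto As)).
by rewrite fM fs mulmx0.
Qed.

(** Suppose that the source lies outside the support of [rho']. If the target
    lies in the common support, [f] vanishes there, against [thin_thin_msupp].
    If it does not, the two convex supports lie on opposite sides of the cut at
    [a], although they meet. *)
Lemma thin_thin_src a : A (src a) -> A' (tgt a) -> A' (src a).
Proof.
move=> As A't; apply: contraT => nA's.
case At: (A (tgt a)).
  have := thin_thin_msupp At A't; rewrite /msupp; case/negP; apply/eqP.
  apply: (row_free_mulmx0 (thin_row_free th onto As)); rewrite fM.
  by rewrite (mx0_cols (rep_map rho' a) (dim0_suppN nA's)) mul0mx.
have [w fw] := msupp_neq0 f0; have /andP[Aw A'w] := msupp_supp fw.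
have [j [i [lti ja]]] := star_arrow S a; rewrite -ltn_predRL in lti.
have nA : ~~ (A (star_arm j i) && A (star_arm j i.+1)).
  by case: ja => -[<- <-]; rewrite At ?andbF.
have nA' : ~~ (A' (star_arm j i) && A' (star_arm j i.+1)).
  by case: ja => -[<- <-]; rewrite (negPf nA's) ?andbF.
have bs := convex_below (@brick_supp_convex _ _ S _ br) lti nA As Aw.
have := convex_below (@brick_supp_convex _ _ S _ br') lti nA' A't A'w.
rewrite -bs; have lti' : (i < star_m (s := S) j)%N.
  by rewrite (leq_trans lti) // leq_pred.
by case: ja => -[-> ->]; rewrite !below_arm ?eqxx ?leqnn ?ltnn // -ltn_predRL.
Qed.

Lemma thin_thin_onto : Fonto rho rho'.
Proof.
move=> y; apply: (rigid_pullback onto' fM) => a.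
case As: (A (src a)); last first.
  by rewrite (mx0_cols (y a)) ?eqxx ?orbT //; apply: dim0_suppN; rewrite As.
case A't: (A' (tgt a)); last first.
  by rewrite (mx0_rows (y a)) ?eqxx ?orbT //; apply: dim0_suppN; rewrite A't.
apply/orP; left; apply: thin_msupp_row_full => //.
by apply: thin_thin_msupp => //; apply: thin_thin_src.
Qed.

End ThinThin.

(** * A thin and a hill representation *)

Section Edges.
Variables (k : fieldType) (Q : quiver) (rho rho' : rep k Q).

(** The family concentrated at [v]; [conform_mx] transports [M] along the
    equality [w = v]. *)
Definition bump v (M : 'M_(dimvec rho' v, dimvec rho v)) :
    vertex_homs k rho rho' :=
  mxfam_of (fun w => if w == v then conform_mx 0 M else 0).

Lemma bump_id v M : @bump v M v = M.
Proof. by rewrite mxfam_ofE eqxx conform_mx_id. Qed.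

Lemma bump_out v M w : w != v -> @bump v M w = 0.
Proof. by move=> wv; rewrite mxfam_ofE (negPf wv). Qed.

Definition edge_onto (a : arrow Q) := forall y : arrow_homs k rho rho',
  (forall b, b != a -> y b = 0) -> exists g, Fmap g = y.

Lemma edge_onto_all : (forall a, edge_onto a) -> Fonto rho rho'.
Proof.
move=> eo y.
pose ya a : arrow_homs k rho rho' :=
  mxfam_of (fun b => if b == a then y b else 0).
have /fin_all_exists[g gE] a : exists g, Fmap g = ya a.
  by apply: (eo a) => b /negPf ba; rewrite mxfam_ofE ba.
exists (\sum_a g a); rewrite linear_sum (eq_bigr ya) => [|a _]; last exact: gE.
apply/mxfamP => b.
have sumE : (\sum_a ya a) b = \sum_a ya a b.
  elim/big_rec2: _ => [|a u v _ <-]; first by rewrite mxfam_0E.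
  by rewrite mxfam_addE.
rewrite sumE (bigD1 b) //= mxfam_ofE eqxx big1 ?addr0 // => a ab.
by rewrite mxfam_ofE eq_sym (negPf ab).
Qed.

(** Let [a] and [c] be the only arrows at [v]. A cocycle supported on [a] that
    agrees at [a] with the coboundary of a family concentrated at [v] differs
    from it by a cocycle supported on [c]. *)
Lemma edge_onto_trans v a c :
  (forall b, (src b == v) || (tgt b == v) -> b = a \/ b = c) ->
  (forall Y, exists M, Fmap (@bump v M) a = Y) ->
  edge_onto c -> edge_onto a.
Proof.
move=> ac aM eoc y ya; have [M ME] := aM (y a).
have [b bc|g gE] := eoc (y - Fmap (bump M)).
  rewrite mxfam_addE mxfam_oppE; have [-> | ba] := eqVneq b a.
    by rewrite ME subrr.
  have /norP[sv tv] : ~~ ((src b == v) || (tgt b == v)).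
    by apply/negP => /ac[] E; [rewrite E eqxx in ba|rewrite E eqxx in bc].
  by rewrite ya // FmapE !bump_out // mul0mx mulmx0 subrr oppr0 addr0.
by exists (g + bump M); rewrite linearD /= gE subrK.
Qed.

Lemma bump_src_onto a : src a != tgt a -> row_free (rep_map rho' a) ->
  forall Y, exists M, Fmap (@bump (src a) M) a = Y.
Proof.
move=> st /row_freeP[R RE] Y; exists (- (R *m Y)).
rewrite FmapE bump_id bump_out 1?eq_sym // mul0mx mulmxN mulmxA RE mul1mx.
by rewrite opprK add0r.
Qed.

Lemma bump_tgt_onto a : src a != tgt a -> row_full (rep_map rho a) ->
  forall Y, exists M, Fmap (@bump (tgt a) M) a = Y.
Proof.
move=> st /row_fullP[L LE] Y; exists (Y *m L).
by rewrite FmapE bump_id bump_out // mulmx0 subr0 -mulmxA LE mulmx1.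
Qed.

End Edges.

Section ThinHill.
Variables (k : fieldType) (Q : quiver) (S : star_shape Q).
Variables (rho rho' : rep k Q) (f : vertex_homs k rho rho').
Hypotheses (th : thin (dimvec rho)) (hi : hill S (dimvec rho')).
Hypotheses (br : brick rho) (onto : Fonto rho rho) (onto' : Fonto rho' rho').
Hypotheses (fM : is_morphism f) (f0 : f <> 0).

Local Notation A := (supp rho).
Local Notation B := (msupp f).
Local Notation arm := (star_arm (s := S)).
Local Notation len j := (star_m (s := S) j).

Let convexA : convex S A. Proof. exact: brick_supp_convex. Qed.
Let subBA : subpred B A. Proof. by move=> v /msupp_supp/andP[]. Qed.

Lemma hill_row_full j i a : (i < (len j).-1)%N ->
  src a = arm j i -> tgt a = arm j i.+1 -> row_full (rep_map rho' a).
Proof.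
move=> lti sa ta; apply: rigid_row_full => //; rewrite sa ta.
by apply: (hi j).1; rewrite -ltn_predRL.
Qed.

Lemma hill_row_free j i a : (i < (len j).-1)%N ->
  src a = arm j i.+1 -> tgt a = arm j i -> row_free (rep_map rho' a).
Proof.
move=> lti sa ta; apply: rigid_row_free => //; rewrite sa ta.
by apply: (hi j).1; rewrite -ltn_predRL.
Qed.

(** If the arrow points to the center, the map of [rho'] along it is injective
    and sends the nonzero value of [f] at the source to a multiple of the value
    at the target. If it points away, the value of [f] at the target, composed
    with the nonzero scalar by which [rho] acts, factors through the value at
    the source. *)
Lemma msupp_up_closed : up_closed S A B.
Proof.
move=> j i lti Bi Ai1.
have [a [ja _]] := star_edge (etrans (esym (ltn_predRL _ _)) lti).
case: ja => -[sa ta].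
  have injr := hill_row_full lti sa ta.
  rewrite -sa in Bi; rewrite -ta; apply: contraNN Bi => /eqP ft.
  by apply/eqP/(row_full_mulmx0 injr); rewrite -fM ft mul0mx.
rewrite -ta in Bi; rewrite -sa in Ai1 *; apply: contraNN Bi => /eqP fs.
apply/eqP/(row_free_mulmx0 (thin_row_free th onto Ai1)).
by rewrite fM fs mulmx0.
Qed.

Lemma msupp_edge j i a : (i < (len j).-1)%N ->
  joins a (arm j i) (arm j i.+1) -> A (src a) -> ~~ B (src a) ->
  A (arm j i.+1) && ~~ B (arm j i.+1).
Proof.
move=> lti ja As nBs; case: ja => -[sa ta]; last by rewrite -sa As.
have [w Bw] := msupp_neq0 f0.
rewrite (up_closed_exit convexA subBA msupp_up_closed Bw) -?sa // -ta.
rewrite /msupp negbK; apply/eqP/(row_free_mulmx0 (thin_row_free th onto As)).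
by rewrite fM (eqP (negbNE nBs)) mulmx0.
Qed.

(** The induction runs from the center outwards. If [f] does not vanish at the
    source of [a], rigidity of [rho'] applies. Otherwise the endpoint of [a]
    nearer to the center is a vertex of the support of [rho] where [f] vanishes,
    hence not the center; bumping at that vertex moves [y] to the next arrow. *)
Lemma thin_hill_edge_onto_step j i a : (i < (len j).-1)%N ->
  joins a (arm j i) (arm j i.+1) ->
  ((i.+1 < (len j).-1)%N -> forall c, joins c (arm j i.+1) (arm j i.+2) ->
    edge_onto rho rho' c) ->
  edge_onto rho rho' a.
Proof.
move=> lti ja IH y ya.
have [fs | nfs] := boolP (row_full (f (src a))).
  apply: (rigid_pullback onto' fM) => b.
  by have [-> | /ya->] := eqVneq b a; rewrite ?fs ?eqxx ?orbT.
have [As | nAs] := boolP (A (src a)); last first.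
  exists 0; rewrite linear0; apply/mxfamP => b; rewrite mxfam_0E.
  have [-> | /ya-> //] := eqVneq b a.
  by rewrite (mx0_cols (y a)) // dim0_suppN.
have nBs : ~~ B (src a) by apply: contra nfs; apply: thin_msupp_row_full.
have /andP[Av nBv] := msupp_edge lti ja As nBs.
have lti1 : (i.+1 < (len j).-1)%N.
  rewrite ltn_neqAle lti andbT; apply: contra nBv => /eqP iE.
  move: Av; rewrite iE star_arm_end => Ac; have [w Bw] := msupp_neq0 f0.
  exact: up_closed_center convexA subBA msupp_up_closed Bw Ac.
have lt2 : (i.+2 < len j)%N by rewrite -ltn_predRL.
have [c [jc c_uniq]] := star_edge lt2.
have [a' [_ a_uniq]] := star_edge (ltnW lt2).
have st : src a != tgt a.
  have ne : arm j i != arm j i.+1.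
    by apply/eqP => /(arm_inj lti (ltnW lt2))[_ /n_Sn].
  by case: ja => -[-> ->] //; rewrite eq_sym.
(* [arm j i.+1] is not the center, so only two arrows meet it. *)
have touch b : (src b == arm j i.+1) || (tgt b == arm j i.+1) -> b = a \/ b = c.
  have [j' [i' [lti' jb]]] := star_arrow S b.
  have : arm j i.+1 = arm j' i' \/ arm j i.+1 = arm j' i'.+1 ->
      b = a \/ b = c.
    case=> /(arm_inj lti1) H.
      have [jE iE] := H (ltnW lti'); right; apply/esym/c_uniq.
      by rewrite iE jE.
    have [jE [iE]] := H lti'; left.
    by rewrite -(a_uniq b) ?iE ?jE // -(a_uniq a) // -jE -iE.
  move=> H /orP[] /eqP bE; apply: H; case: jb bE => -[sE tE];
    by rewrite ?sE ?tE => ->; auto.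
apply: (edge_onto_trans touch _ (IH lti1 c jc)) ya => //.
case: ja => -[sa ta].
  by rewrite -ta; apply: bump_tgt_onto => //; apply: thin_row_full; rewrite ?ta.
by rewrite -sa; apply: bump_src_onto => //; apply: hill_row_free sa ta.
Qed.

Lemma thin_hill_onto : Fonto rho rho'.
Proof.
apply: edge_onto_all => a; have [j [i [lti ja]]] := star_arrow S a.
rewrite -ltn_predRL in lti.
have [d dE] : exists d, (i + d.+1 = (len j).-1)%N.
  by exists ((len j).-1 - i.+1)%N; rewrite addnS -addSn subnKC.
move=> {lti}; elim: d i a dE ja => [|d IH] i a dE ja.
  apply: (thin_hill_edge_onto_step (i := i)) ja _; rewrite -dE addn1 //.
  by rewrite ltnn.
have lti : (i < (len j).-1)%N by rewrite -dE -addSnnS leq_addr.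
apply: (thin_hill_edge_onto_step lti ja) => _ c; apply: IH.
by rewrite addSnnS.
Qed.

End ThinHill.

(** * Duality and the conclusion *)

Section Duality.
Variables (k : fieldType) (Q : quiver).
Implicit Types rho : rep k Q.

Definition op_quiver : quiver := Quiver (@tgt Q) (@src Q).

Lemma joins_op (a : arrow Q) (x y : Q) :
  joins (Q := op_quiver) a x y <-> joins a x y.
Proof. by rewrite /joins /=; tauto. Qed.

Lemma op_star_edge (S : star_shape Q) (j : 'I_(star_r S)) i :
  (i.+1 < star_m j)%N ->
  exists! a : arrow op_quiver,
    joins (Q := op_quiver) a (star_arm j i) (star_arm j i.+1).
Proof.
move=> /(star_edge (s := S))[a [ja a_uniq]]; exists a; split.
  exact/joins_op.
by move=> b /joins_op; apply: a_uniq.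
Qed.

Lemma op_star_arrow (S : star_shape Q) (a : arrow op_quiver) :
  exists (j : 'I_(star_r S)) i, (i.+1 < star_m j)%N /\
    joins (Q := op_quiver) a (star_arm j i) (star_arm j i.+1).
Proof.
have [j [i [lti ja]]] := star_arrow S a.
by exists j, i; split=> //; apply/joins_op.
Qed.

Definition op_star (S : star_shape Q) : star_shape op_quiver :=
  @StarShape op_quiver (star_r S) (@star_m Q S) (star_center S) (@star_arm Q S)
    (star_r_ge3 S) (@star_m_ge2 Q S) (@star_arm_end Q S)
    (@star_arm_neq_center Q S) (@star_arm_inj Q S) (@star_cover Q S)
    (@op_star_edge S) (@op_star_arrow S).

Definition dual_rep rho : rep k op_quiver :=
  @Rep k op_quiver (dimvec rho) (fun a => (rep_map rho a)^T).

Definition tr_fam (I : finType) (m n : I -> nat) (f : mxfam k m n) :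
  mxfam k n m := mxfam_of (fun i => (f i)^T).

Lemma tr_famE (I : finType) (m n : I -> nat) (f : mxfam k m n) i :
  tr_fam f i = (f i)^T.
Proof. exact: mxfam_ofE. Qed.

Lemma tr_famK (I : finType) (m n : I -> nat) :
  cancel (@tr_fam I m n) (@tr_fam I n m).
Proof. by move=> f; apply/mxfamP => i; rewrite !mxfam_ofE trmxK. Qed.

Lemma Fmap_dual rho rho' (f : vertex_homs k rho rho') :
  @Fmap k op_quiver (dual_rep rho') (dual_rep rho) (tr_fam f)
    = - tr_fam (Fmap f).
Proof.
apply/mxfamP => a; rewrite FmapE mxfam_oppE !mxfam_ofE /=.
by rewrite -!trmx_mul linearB opprB.
Qed.

Lemma Fonto_dual rho rho' :
  Fonto rho rho' <-> Fonto (dual_rep rho') (dual_rep rho).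
Proof.
split=> onto y.
  have [f fE] := onto (- tr_fam y); exists (tr_fam f).
  rewrite Fmap_dual fE; apply/mxfamP => a.
  by rewrite mxfam_oppE tr_famE mxfam_oppE tr_famE linearN /= trmxK opprK.
have [f fE] := onto (- tr_fam y); exists (tr_fam f).
apply: (can_inj (@tr_famK _ _ _)); apply: oppr_inj.
by rewrite -Fmap_dual tr_famK fE.
Qed.

Lemma is_morphism_dual rho rho' (f : vertex_homs k rho rho') :
  is_morphism f ->
  @is_morphism k op_quiver (dual_rep rho') (dual_rep rho) (tr_fam f).
Proof. by move=> fM a; rewrite !mxfam_ofE /= -!trmx_mul fM. Qed.

Lemma brick_dual rho : brick rho -> brick (dual_rep rho).
Proof.
move=> br f fM; have [|c fE] := br (tr_fam f).
  move=> a; rewrite !mxfam_ofE; have /(congr1 trmx) := fM a.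
  by rewrite /= !trmx_mul !trmxK.
exists c; rewrite -[LHS]tr_famK fE; apply/mxfamP => i.
by rewrite mxfam_ofE !mxfam_scaleE !mxfam_ofE linearZ /= trmx1.
Qed.

End Duality.

Section Conclusion.
Variables (k : fieldType) (Q : quiver) (S : star_shape Q).
Implicit Types rho : rep k Q.

Lemma exceptional_rigid rho : exceptional rho -> Fonto rho rho.
Proof. by case=> _; apply: Ext1_eq0_onto. Qed.

Lemma exceptional_brick rho : exceptional rho -> brick rho.
Proof. by case=> br _ f /mem_HomRep/br[c [fE _]]; exists c. Qed.

(** Transposing a morphism from a hill to a thin representation gives one from a
    thin to a hill representation of the opposite star. *)
Lemma exceptional_hom_onto rho rho' (f : vertex_homs k rho rho') :
  exceptional rho -> exceptional rho' ->
  hill S (dimvec rho) \/ thin (dimvec rho) ->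
  hill S (dimvec rho') \/ thin (dimvec rho') ->
  ~ (hill S (dimvec rho) /\ hill S (dimvec rho')) ->
  is_morphism f -> f <> 0 -> Fonto rho rho'.
Proof.
move=> exc exc' + + nhh fM f0.
have [onto onto'] := (exceptional_rigid exc, exceptional_rigid exc').
have [br br'] := (exceptional_brick exc, exceptional_brick exc').
case=> [hi | th] [hi' | th'].
- by case: nhh.
- apply/Fonto_dual.
  apply: (@thin_hill_onto k (op_quiver Q) (op_star S)
    (dual_rep rho') (dual_rep rho) (tr_fam f)) => //.
  + exact: brick_dual.
  + exact: (Fonto_dual rho' rho').1.
  + exact: (Fonto_dual rho rho).1.
  + exact: is_morphism_dual.
  + move=> tf0; apply: f0; rewrite -[f]tr_famK tf0.
    by apply/mxfamP => i; rewrite mxfam_ofE !mxfam_0E trmx0.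
- exact: (@thin_hill_onto k Q S rho rho' f).
- exact: (@thin_thin_onto k Q S rho rho' f).
Qed.

End Conclusion.

Unset Implicit Arguments.

Theorem proposition6p5 (k : closedFieldType) (Q : quiver) (S : star_shape Q)
  (rho rho' : rep k Q)
  (exc : exceptional rho) (exc' : exceptional rho')
  (hill_or_thin : hill S (dimvec rho) \/ thin (dimvec rho))
  (hill_or_thin' : hill S (dimvec rho') \/ thin (dimvec rho'))
  (not_both_hill : ~ (hill S (dimvec rho) /\ hill S (dimvec rho'))) :
  maximal_rank (F rho rho') /\ (dim_hom rho rho' = 0%N \/ Ext1_eq0 rho rho').
Proof.
have [ker0 | kerN0] := eqVneq (HomRep rho rho') 0%VS.
  split; last by left; rewrite /dim_hom ker0 dimv0.
  by left; apply/lker0P; rewrite -[lker _]/(HomRep rho rho') ker0.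
have onto : Fonto rho rho'.
  have := vpick0 (HomRep rho rho'); rewrite (negPf kerN0) => /negbT/eqP f0.
  have /mem_HomRep fM := memv_pick (HomRep rho rho').
  exact: exceptional_hom_onto exc exc' hill_or_thin hill_or_thin' not_both_hill
    fM f0.
split; last by right; apply: onto_Ext1_eq0.
by right=> y; have [f fE] := onto y; exists f; rewrite lfunE.
Qed.
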